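(* For each positive integer $n$ there exists a scattered space $X$ such that $\mathbf{OF}(X)$ is an $n$-element chain.
   Context: All topological spaces are assumed to be Hausdorff and infinite. A space is scattered if each of its nonempty subspaces contains an isolated point. Filters are proper. A filter $\mathcal F$ on a space $X$ is open if it has a base consisting of open sets, and free if every $x\in X$ has an open neighborhood $U$ with $X\setminus U\in\mathcal F$. $\mathbf{OF}(X)$ is the poset of all free open filters on $X$, ordered by inclusion. *)

(* Defs.v *)
From mathcomp Require Import all_boot all_order.
From mathcomp Require Import boolp classical_sets functions cardinality filter.
From mathcomp Require Import topology.

Set Implicit Arguments.
Unset Strict Implicit.
Unset Printing Implicit Defensive.

Local Open Scope classical_set_scope.

Definition scattered_space (X : topologicalType) : Prop :=
  forall A : set X, A !=set0 -> isolated A !=set0.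

Definition open_filter (X : topologicalType) (F : set_system X) : Prop :=
  exists B : set_system X,
    [/\ B `<=` F, B `<=` open & forall A, F A -> exists2 U, B U & U `<=` A].

Definition free_filter (X : topologicalType) (F : set_system X) : Prop :=
  forall x : X, exists U : set X, open_nbhs x U /\ F (~` U).

Definition OF (X : topologicalType) : set (set_system X) :=
  [set F | [/\ ProperFilter F, open_filter F & free_filter F]].

Arguments OF X : clear implicits.

Definition is_chain_of_size (T : Type) (P : set (set_system T)) (n : nat) :
    Prop :=
  total_on P subset /\ (P #= `I_n)%card.

(* Main.v *)
(** Fix a free ultrafilter [p] on [nat] and consider a tree of height [n] whose
inner nodes have children indexed by [nat], a set being open when with each
node it contains [p]-many of its children.  Each node is the limit of exactly one
ultrafilter on the set of leaves; let [r] be the one belonging to the root, and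
delete the root.  To the remaining tree add a second copy of the leaves, as
isolated points, together with a point for each free ultrafilter [q] on this copy,
which is also made a limit of [q] on the original leaves, unless [q] is [r] or the
ultrafilter of a node of the tree.  By compactness of the space of ultrafilters, a
free open filter [F] contains the complement of the closure of the second copy,
i.e. the tree, and its trace on the leaves is [r].  An open set of the tree that
traces [B] on the leaves consists of nodes whose ultrafilter contains [B], so [F]
contains the neighbourhood trace of the root; it is then determined by the least
[k] such that it contains the union of the [k] lowest levels, and each [k] with
[0 < k <= n] occurs. *)

Require Import Defs.
From HB Require Import structures.
From mathcomp Require Import all_boot all_order.
From mathcomp Require Import boolp classical_sets functions cardinality filter.
From mathcomp Require Import topology.

Local Open Scope classical_set_scope.

(** * Topologies given by a filter at each point *)

Section LocalFilters.
Context {X : Type} (N : X -> set_system X) (NF : forall x, Filter (N x)).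

(** An alias carrying the filter proofs in its type, so that the topology can be inferred from
    it. *)
Definition local_filters_space of (forall x, Filter (N x)) : Type := X.

Local Notation space := (local_filters_space NF).

(** [N x] need not be the neighbourhood filter of [x]: its members may even miss [x]. *)
Definition local_filters_open : set_system space :=
  [set W | forall x, W x -> N x W].

Lemma local_filters_openT : local_filters_open setT.
Proof. by move=> x _; exact: filterT. Qed.

Lemma local_filters_openI : setI_closed local_filters_open.
Proof. by move=> A B oA oB x [Ax Bx]; apply: filterI; [exact: oA|exact: oB]. Qed.

Lemma local_filters_open_bigU (I : Type) (f : I -> set space) :
  (forall i, local_filters_open (f i)) -> local_filters_open (\bigcup_i f i).
Proof.
by move=> fo x [i _ fix_]; apply: (filterS (bigcup_sup _) (fo i x fix_)).
Qed.

HB.instance Definition _ := gen_eqMixin space.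
HB.instance Definition _ := gen_choiceMixin space.
HB.instance Definition _ := isOpenTopological.Build space
  local_filters_openT local_filters_openI local_filters_open_bigU.

Lemma openNE (W : set space) : open W = (forall x, W x -> N x W).
Proof. by []. Qed.

(** A point of least rank in [A] is isolated in [A]: together with all points of smaller rank it
    forms an open set. *)
Lemma scattered_local_filters (rk : X -> nat) :
  (forall x, N x [set y | y = x \/ (rk y < rk x)%N]) -> scattered_space space.
Proof.
move=> Nrk A [a Aa].
have exA : exists k, `[< exists2 x : space, A x & rk x = k >].
  by exists (rk a); apply/asboolP; exists a.
case: (ex_minnP exA) => k /asboolP[x Ax rkx] kmin.
exists x; split; first by rewrite inE.
exists [set y | y = x \/ (rk y < rk x)%N].
  apply: open_nbhs_nbhs; split; last by left.
  rewrite openNE => y yx; apply: filterS (Nrk y) => z [->//|zy]; right.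
  case: yx => [<-//|]; exact: ltn_trans.
apply/seteqP; split=> [y [[//|yx] Ay]|y ->]; last by split=> //; left.
have /kmin : `[< exists2 z : space, A z & rk z = rk y >].
  by apply/asboolP; exists y.
by rewrite -rkx leqNgt yx.
Qed.

End LocalFilters.

(** * Ultrafilters *)

Lemma ultrafilterP {T : Type} (F : set_system T) :
  ProperFilter F -> (forall A, F A \/ F (~` A)) -> UltraFilter F.
Proof.
move=> FF FC; split=> // G GF FG; apply/seteqP; split=> // A GA.
case: (FC A) => // /FG GCA; case: (filter_not_empty G).
by rewrite -(setICr A); exact: filterI.
Qed.

Lemma ultraC {T : Type} {F : set_system T} (A : set T) :
  UltraFilter F -> F (~` A) = ~ F A.
Proof.
move=> FU; apply/propext; split=> [FCA FA|FA].
  by apply: (filter_not_empty F); rewrite -(setICr A); exact: filterI.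
by case: (in_ultra_setVsetC A FU).
Qed.

Lemma ultra_neqP {T : Type} (F G : set_system T) :
  UltraFilter F -> UltraFilter G -> F <> G -> exists2 A, F A & G (~` A).
Proof.
move=> FU GU FG; apply: contrapT => noA; apply: FG; symmetry.
apply: max_filter => A FA; apply: contrapT => GA; apply: noA; exists A => //.
by rewrite ultraC.
Qed.

(* Compactness of the space of ultrafilters. *)
Lemma filter_set0_ultra {T : Type} (F : set_system T) : Filter F ->
  (forall q, UltraFilter q -> exists2 A, q A & F (~` A)) -> F set0.
Proof.
move=> FF Fq; apply: contrapT => F0.
have /ultraFilterLemma[q [qU Fleq]] : ProperFilter F by split.
by have [A qA /Fleq] := Fq _ qU; rewrite ultraC.
Qed.

Lemma free_ultrafilter_nat :
  exists2 p : set_system nat, UltraFilter p & forall k, ~ p [set k].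
Proof.
have [p [pU infp]] := ultraFilterLemma eventually_filter.
exists p => // k; rewrite -ultraC; apply: infp.
by exists k.+1 => // j /= kj jk; move: kj; rewrite jk ltnn.
Qed.

(** * Iterated limits along [p] *)

Section Tree.
Context {p : set_system nat} {pU : UltraFilter p} (pfree : forall k, ~ p [set k]).

(* The sequences [p]-almost all of whose one-term extensions lie in [A]. *)
Definition ext (A : set (seq nat)) : set (seq nat) :=
  [set s | p [set k | A (k :: s)]].

Lemma extS A B : A `<=` B -> ext A `<=` ext B.
Proof. by move=> AB s; apply: filterS => k; exact: AB. Qed.

Lemma extT : ext setT = setT.
Proof. by apply/seteqP; split=> // s _; exact: filterT. Qed.

Lemma extI A B : ext (A `&` B) = ext A `&` ext B.
Proof.
apply/seteqP; split=> s; last by case; exact: filterI.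
by move=> ABs; split; apply: filterS ABs => k [].
Qed.

Lemma extC A : ext (~` A) = ~` ext A.
Proof.
by apply/seteqP; split=> s; rewrite /ext /= -ultraC.
Qed.

Lemma ext_behead A : ext (behead @^-1` A) = A.
Proof.
apply/seteqP; split=> s; last by move=> As; apply: filterS filterT.
by move=> /filter_ex[k].
Qed.

Lemma ext1 s : ext [set s] = set0.
Proof.
apply/seteqP; split=> // t; case: s => [/filter_ex[]//|k s] ks.
by apply: (pfree k); apply: filterS ks => j [].
Qed.

(** The [i]-fold Fubini power of [p], carried by the extensions of [s] by [i] terms, which are the
    leaves below the node [(i, s)]. *)
Definition lim (i : nat) (s : seq nat) : set_system (seq nat) :=
  [set A | iter i ext A s].

Lemma iter_ext0 i : iter i ext set0 = set0.
Proof. by elim: i => //= i ->; rewrite -setCT extC extT. Qed.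

Lemma iter_extT i : iter i ext setT = setT.
Proof. by elim: i => //= i ->; rewrite extT. Qed.

Lemma iter_extS i A B : A `<=` B -> iter i ext A `<=` iter i ext B.
Proof. by move=> AB; elim: i => //= i; exact: extS. Qed.

Lemma iter_extI i A B :
  iter i ext (A `&` B) = iter i ext A `&` iter i ext B.
Proof. by elim: i => //= i ->; rewrite extI. Qed.

Lemma iter_extC i A : iter i ext (~` A) = ~` iter i ext A.
Proof. by elim: i => //= i ->; rewrite extC. Qed.

(** Turns a set of nodes of level [i] into the set of leaves below them without losing
    information. *)
Lemma iter_ext_behead i A : iter i ext (iter i behead @^-1` A) = A.
Proof.
elim: i A => // i IH A; rewrite iterSr.
rewrite (_ : _ @^-1` A = behead @^-1` (iter i behead @^-1` A)).
  by rewrite ext_behead IH.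
by apply/seteqP; split=> s /=; rewrite -iterSr.
Qed.

#[global] Instance lim_ultra i s : UltraFilter (lim i s).
Proof.
apply: ultrafilterP => [|A]; last first.
  by rewrite /lim /= iter_extC; exact: lem.
split; first by rewrite /lim /= iter_ext0.
split; rewrite /lim /=; first by rewrite iter_extT.
  by move=> A B As Bs; rewrite /= iter_extI.
by move=> A B AB; exact: iter_extS.
Qed.

(** The extensions of [s] by [i] terms belong to [lim i s]. If they belong to [lim j t] with
    [i < j], then some [ext] of a singleton is nonempty, against the freeness of [p]. *)
Lemma lim_inj i j s t : lim i s = lim j t -> i = j /\ s = t.
Proof.
wlog leij : i j s t / (i <= j)%N.
  move=> H; case/orP: (leq_total i j) => [|ji] ij; first exact: H.
  by have [] := H _ _ _ _ ji (esym ij).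
move=> ij; have : lim j t (iter i behead @^-1` [set s]).
  by rewrite -ij /lim /= iter_ext_behead.
rewrite /lim /= -(subnK leij) iterD iter_ext_behead.
case: (j - i)%N => [|k]; first by move=> /= ->; rewrite add0n.
by rewrite iterSr ext1 iter_ext0.
Qed.

(** * The space and its basic open sets *)

Context (m : nat).

Definition ultra : Type := {q : set_system (seq nat) | UltraFilter q}.

Lemma ultra_inj (q q' : ultra) : sval q = sval q' -> q = q'.
Proof.
case: q q' => [q qU] [q' q'U] /= qq'; case: _ / qq' q'U => q'U.
by rewrite (Prop_irrelevance qU q'U).
Qed.

Definition limu (i : nat) (s : seq nat) : ultra := exist _ (lim i s) (lim_ultra i s).

(* Every level is indexed by [seq nat], the children of [(i.+1, s)] being the nodes
   [(i, k :: s)]; [i = 0] for leaves, and the height [n] is [m.+1].  The deleted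
   root is [(m.+1, [::])].  Nodes that are not below it, such as [(i, [::])], do no
   harm: [r] does not see them. *)
Definition pt : Type := ('I_m.+1 * seq nat) + ultra.

Definition node (i : nat) (s : seq nat) : pt := inl (inord i, s).

Definition level (i : nat) (W : set pt) : set (seq nat) :=
  [set s | W (node i s)].

(* Principal ultrafilters play the role of the second copy of the leaves. *)
Definition shadow (W : set pt) : set (seq nat) :=
  [set s | W (inr (limu 0 s))].

(** The ultrafilters on the leaves that get no added limit: those of nodes, whose limit must stay
    unique, and that of the deleted root, which must have none. *)
Definition in_tree (q : ultra) : Prop :=
  (exists i s, (i <= m)%N /\ q = limu i s) \/ q = limu m.+1 [::].

(** Leaves are isolated, and so are the principal ultrafilters: they satisfy [in_tree] with [i = 0],
    and [shadow] tests membership of the point itself. *)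
Definition nbase (x : pt) : set_system pt :=
  match x with
  | inl (i, s) =>
      if nat_of_ord i is j.+1 then [set W | ext (level j W) s] else [set W | W x]
  | inr q =>
      [set W | sval q (shadow W) /\ (~ in_tree q -> sval q (level 0 W))]
  end.

Lemma nbase_filter x : Filter (nbase x).
Proof.
case: x => [[[[|j] jm] s]|[q qU]] /=.
- by split=> // A B AB; exact: AB.
- split=> [|A B As Bs|A B AB]; rewrite /ext /=.
  + exact: filterT.
  + exact: filterI.
  + by apply: filterS => k; exact: AB.
- split=> [|A B [qA qA0] [qB qB0]|A B AB [qA qA0]] /=.
  + by split=> [|_]; exact: filterT.
  + split=> [|qn]; first exact: filterI.
    by apply: filterI; [exact: qA0|exact: qB0].
  + split=> [|/qA0]; first by apply: filterS qA => s; exact: AB.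
    by apply: filterS => s; exact: AB.
Qed.

Local Notation space := (local_filters_space nbase nbase_filter).

Lemma inl_node (i : 'I_m.+1) s : inl (i, s) = node i s.
Proof. by rewrite /node inord_val. Qed.

Lemma node_inj i j s t : (i <= m)%N -> (j <= m)%N ->
  node i s = node j t -> i = j /\ s = t.
Proof.
by move=> im jm [/(congr1 (@nat_of_ord _))]; rewrite !inordK.
Qed.

Lemma openPE (W : set space) : open W <->
  (forall i, (i < m)%N -> level i.+1 W `<=` ext (level i W)) /\
  (forall q, W (inr q) ->
    sval q (shadow W) /\ (~ in_tree q -> sval q (level 0 W))).
Proof.
rewrite openNE; split=> [oW|[oWn oWq]].
  by split=> [i im s /oW|q /oW//]; rewrite /= inordK.
case=> [[i s]|q] Wx; last exact: oWq.
case: i Wx => [[|j] jm] //= Wx; apply: oWn => //; rewrite /level /=.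
by rewrite /node (_ : inord _ = Ordinal jm) //; apply: val_inj; rewrite /= inordK.
Qed.

Lemma open_level (W : set space) i k : open W -> (i + k <= m)%N ->
  level (i + k) W `<=` iter k ext (level i W).
Proof.
move=> /openPE[oW _]; elim: k => [_|k IH]; first by rewrite addn0 => s.
rewrite addnS => ikm; apply: subset_trans (oW _ ikm) _.
by apply: extS; apply: IH; exact: ltnW.
Qed.

Lemma open_lim (W : set space) i s : open W -> (i <= m)%N ->
  W (node i s) -> lim i s (level 0 W).
Proof. by move=> oW im; apply: (@open_level W 0 i). Qed.

(* The closure in the tree of the set [A] of leaves, which is also open. *)
Definition hull (A : set (seq nat)) : set space :=
  [set x : pt | if x is inl (i, s) then lim i s A else False].

Definition below (k : nat) : set space :=
  [set x : pt | if x is inl (i, _) then (i < k)%N else False].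

Definition nb (q : ultra) (A : set (seq nat)) : set space :=
  [set x : pt | match x with
           | inl (i, s) => [/\ i = 0 :> nat, A s & ~ in_tree q]
           | inr q' => q' = q \/ exists2 s, A s & q' = limu 0 s
           end].

Lemma level_hull A i : (i <= m)%N -> level i (hull A) = iter i ext A.
Proof. by move=> im; rewrite /level /hull /= inordK. Qed.

Lemma level_below k i : (i <= m)%N -> level i (below k) = [set _ | (i < k)%N].
Proof. by move=> im; rewrite /level /below /= inordK. Qed.

Lemma open_hull A : open (hull A).
Proof.
by apply/openPE; split=> // i im; rewrite !level_hull // ltnW.
Qed.

Lemma open_below k : open (below k).
Proof.
apply/openPE; split=> // i im; rewrite !level_below ?(ltnW im)// => s /= ik.
by apply: filterS filterT => j _; exact: ltnW.
Qed.

Lemma in_tree0 s : in_tree (limu 0 s).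
Proof. by left; exists 0, s. Qed.

Lemma open_nb (q : ultra) A : sval q A -> open (nb q A).
Proof.
move=> qA; apply/openPE; split=> [i im s|q' /= [->|[s As ->]]].
- by rewrite /level /nb /= inordK // => -[].
- have qU := svalP q; split=> [|qn]; apply: filterS qA => s As /=.
    by right; exists s.
  by rewrite /level /nb /= inordK.
- split=> /=; last by case; exact: in_tree0.
  by rewrite /lim /= /shadow /=; right; exists s.
Qed.

(** * Separation and scatteredness *)

Definition point_ultra (x : space) : ultra :=
  match x with inl (i, s) => limu i s | inr q => q end.

Definition nbd (x : space) (A : set (seq nat)) : set space :=
  match x with inl _ => hull A | inr q => nb q A end.

Lemma nbdP x A : sval (point_ultra x) A -> open_nbhs x (nbd x A).
Proof.
case: x => [[i s]|q] /= xA; split=> //; first exact: open_hull.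
  exact: open_nb.
by left.
Qed.

Lemma nbd_sub x A : sval (point_ultra x) A ->
  nbd x A `<=` [set y | sval (point_ultra y) A].
Proof.
case: x => [[i s]|q] qA [[j t]|q'] //=; first by case=> -> At _.
by case=> [->//|[t At ->]].
Qed.

Lemma hausdorff_space_pt : hausdorff_space space.
Proof.
rewrite open_hausdorff => x y /eqP xy.
suff [A [B [oA oB]]] : exists A B, [/\ open_nbhs x A, open_nbhs y B
    & A `&` B `<=` set0].
  case: oA => oA Ax; case: oB => oB By AB.
  exists (A, B); first by rewrite !inE.
  by split=> //; apply/eqP/seteqP; split.
have [pxy|pxy] := pselect (point_ultra x = point_ultra y); last first.
  have [] := @ultra_neqP _ _ _ (svalP (point_ultra x)) (svalP (point_ultra y)).
    by move=> /ultra_inj.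
  move=> A xA yA; exists (nbd x A), (nbd y (~` A)); split; try exact: nbdP.
  move=> z [/(nbd_sub _ _ xA) zA /(nbd_sub _ _ yA)] /=.
  by have := svalP (point_ultra z) => ?; rewrite ultraC.
(* Distinct points with the same ultrafilter are a node and an added point; the latter then
   satisfies [in_tree], so its neighbourhood contains no leaf. *)
exists (nbd x setT), (nbd y setT); split.
- apply: nbdP; have := svalP (point_ultra x) => ?; exact: filterT.
- apply: nbdP; have := svalP (point_ultra y) => ?; exact: filterT.
have inlT (i : 'I_m.+1) s : in_tree (limu i s).
  by left; exists i, s; rewrite -ltnS.
case: x y xy pxy => [[i s]|q] [[j t]|q'] /= xy pxy z [].
- by case: xy; move/(congr1 sval): pxy => /lim_inj[] // /val_inj-> ->.
- by case: z => [[k u]|] //= _ []; rewrite -pxy.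
- by case: z => [[k u]|] //= []; rewrite pxy.
- by case: xy; rewrite pxy.
Qed.

Lemma infinite_pt : infinite_set [set: space].
Proof.
have : infinite_set ((fun k => node 0 [:: k] : space) @` [set: nat]).
  rewrite (eq_finite_set (inj_card_eq _)); first exact: infinite_nat.
  by move=> i j _ _ /node_inj[] // _ [].
exact: sub_infinite_set.
Qed.

Lemma scattered_pt : scattered_space space.
Proof.
pose rk (x : pt) := match x with
  | inl (i, _) => nat_of_ord i
  | inr q => if `[< exists s, q = limu 0 s >] then 0 else 1
  end.
apply: (@scattered_local_filters _ _ _ rk); case=> [[[[|j] jm] s]|q] /=.
- by left.
- by apply: filterS filterT => k _; right; rewrite /= inordK // ltnW.
case: asboolP => [[s ->]|qn]; last first.
  have qU := svalP q; split=> [|_]; apply: filterS filterT => s _; right=> /=.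
    by case: asboolP => // -[]; exists s.
  by rewrite inordK.
split; last by case; exact: in_tree0.
by rewrite /lim /= /shadow /=; left.
Qed.

(** * The filters of the chain *)

Definition chain_filter (k : nat) : set_system space :=
  [set W | exists2 B, lim m.+1 [::] B & hull B `&` below k `<=` W].

Lemma chain_filterS k l : (k <= l)%N -> chain_filter l `<=` chain_filter k.
Proof.
move=> kl W [B rB BW]; exists B => //; apply: subset_trans BW.
by move=> [[i s]|q] [//= Bs ik]; split=> //=; exact: leq_trans kl.
Qed.

(** Tells the filters apart: for [B] in the root's ultrafilter, [hull B] has nodes on every
    level. *)
Lemma chain_filter_below k l : (l <= m)%N ->
  chain_filter k (below l) -> (k <= l)%N.
Proof.
move=> lm [B rB Bl]; rewrite leqNgt; apply/negP => lk.
have [s Bs] : iter l ext B !=set0.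
  apply/set0P/eqP => B0; move: rB; rewrite /lim /= -iterS.
  by rewrite -(subnK (leqW lm)) iterD B0 iter_ext0.
have /Bl : (hull B `&` below k) (node l s).
  by rewrite /hull /below /=; split; rewrite /= inordK.
by rewrite /below /= inordK // ltnn.
Qed.

Lemma chain_filter_OF k : (0 < k)%N -> OF space (chain_filter k).
Proof.
move=> k0; split.
- split.
    move=> [B /filter_ex[s Bs]] /(_ (node 0 s)); apply.
    by split; rewrite /hull /below /= inordK.
  split=> [|V W [A rA AV] [B rB BW]|V W VW [B rB BV]].
  + by exists setT => //; exact: filterT.
  + exists (A `&` B); first exact: filterI.
    move=> [[i s]|q] [//=]; rewrite /lim /= iter_extI => -[As Bs] ik.
    by split; [apply: AV|apply: BW]; split.
  + by exists B => //; exact: subset_trans VW.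
- exists [set hull B `&` below k | B in lim m.+1 [::]]; split.
  + by move=> _ [B rB <-]; exists B.
  + by move=> _ [B rB <-]; apply: openI; [exact: open_hull|exact: open_below].
  + by move=> W [B rB BW]; exists (hull B `&` below k) => //; exists B.
(* No node has the root's ultrafilter; the added point that has it is kept away from the whole
   tree. *)
- move=> x; have [xr|xr] := pselect (point_ultra x = limu m.+1 [::]).
    exists (nbd x setT); split.
      by apply: nbdP; rewrite xr; exact: filterT.
    exists setT; first exact: filterT.
    case: x xr => [[i s]|q] /= qr.
      move/(congr1 sval): qr => /lim_inj[im _].
      by have := ltn_ord i; rewrite im ltnn.
    by case=> [[i s]|q'] [//= _ _] [_ _]; apply; right.
  have [] := @ultra_neqP _ _ _ (svalP (point_ultra x)) (lim_ultra m.+1 [::]).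
    by move=> xE; apply: xr; exact: ultra_inj.
  move=> A xA rA; exists (nbd x A); split; first exact: nbdP.
  exists (~` A) => // y [yA _] /(nbd_sub _ _ xA).
  case: y yA => [[i s]|q] //=; rewrite -/(lim i s (~` A)).
  by rewrite ultraC.
Qed.

(** * Classification of the free open filters *)

Lemma open_filter_ex {T : topologicalType} (F : set_system T) A :
  open_filter F -> F A -> exists2 U, F U & open U /\ U `<=` A.
Proof.
move=> [B [BF Bo FB]] /FB[U BU UA]; exists U; first exact: BF.
by split=> //; exact: Bo.
Qed.

(** This trace may be improper: it contains [set0] exactly when [F] contains the complement of the
    image of [C]. *)
Lemma trace_filter {S T : Type} (F : set_system T) (f : S -> T) (C : set S) :
  Filter F -> Filter [set A | F [set x | forall s, C s -> x = f s -> A s]].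
Proof.
move=> FF; split=> [|A B|A B AB] /=.
- by apply: filterS filterT.
- by apply: filterS2 => x xA xB s Cs xs; split; [exact: xA|exact: xB].
- by apply: filterS => x xA s Cs xs; apply: AB; exact: xA.
Qed.

(** Freeness at each [inr q] makes the trace of [F] on the second copy improper. An open member of
    [F] avoiding that copy contains no [inr q], as its shadow would be in [q]. *)
Lemma OF_tree F : OF space F -> F (below m.+1).
Proof.
move=> [FF Fo Ff].
pose e s : space := inr (limu 0 s).
have : F [set x | forall s, setT s -> x = e s -> False].
  apply: (@filter_set0_ultra _ _ (trace_filter F e setT _)) => q qU.
  have [U [[oU Uq] FU]] := Ff (inr (exist _ q qU)).
  move/openPE: oU => [_ /(_ _ Uq)[/= qU' _]].
  exists (shadow U) => //; apply: filterS FU => x Ux s _ xs.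
  by rewrite xs in Ux.
move=> /(open_filter_ex _ _ Fo)[U FU [/openPE[_ oU] Ue]].
apply: filterS FU => -[[i s]|q] Ux /=; first exact: ltn_ord.
have [qS _] := oU _ Ux; have qU := svalP q.
by have [s /Ue] := filter_ex qS; apply.
Qed.

(** An ultrafilter [q] without [B] is not the root's, so it converges on the leaves to some point,
    where freeness applies. Hence some open member of [F] has all its leaves in [B], and its nodes
    lie in [hull B]. *)
Lemma OF_hull F B : OF space F -> lim m.+1 [::] B -> F (hull B).
Proof.
move=> FOF rB; have Ft := OF_tree _ FOF; case: FOF => FF Fo Ff.
have : F [set x : space | forall s, (~` B) s -> x = node 0 s -> False].
  apply: (@filter_set0_ultra _ _ (trace_filter F (node 0) (~` B) _)) => q qU.
  have [qB|] := pselect (q B).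
    by exists B => //=; apply: filterS filterT => x _ s.
  move=> qB; pose u : ultra := exist _ q qU.
  suff [U [oU qU' FU]] : exists U : set space,
      [/\ open U, q (level 0 U) & F (~` U)].
    exists (level 0 U) => //; apply: filterS FU => x Ux s _ xs.
    by rewrite xs in Ux.
  have [[[i [s [im /(congr1 sval) /= qE]]]|/(congr1 sval) /= qE]|qn] :=
    pselect (in_tree u).
  - have [U [[oU Us] FU]] := Ff (node i s).
    by exists U; split=> //; rewrite qE; exact: open_lim.
  - by rewrite qE in qB.
  - have [U [[oU Uq] FU]] := Ff (inr u); exists U; split=> //.
    by move/openPE: oU => [_ /(_ _ Uq)[_]]; apply.
move=> /(open_filter_ex _ _ Fo)[U FU [oU UB]].
apply: filterS (filterI FU Ft) => -[[i s]|q] [Ux //= _].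
rewrite inl_node in Ux.
have : lim i s (level 0 U) by apply: open_lim => //; rewrite -ltnS.
apply: filterS => t Ut; apply: contrapT => Bt.
exact: UB Ut t Bt erefl.
Qed.

Lemma OF_chain_filter F : OF space F ->
  exists2 k, (0 < k <= m.+1)%N & F = chain_filter k.
Proof.
move=> FOF; have exk : exists k, `[< F (below k) >].
  by exists m.+1; apply/asboolP; exact: OF_tree.
case: (ex_minnP exk) => k /asboolP Fk kmin.
have km : (k <= m.+1)%N by apply: kmin; apply/asboolP; exact: OF_tree.
have Fhull B := OF_hull F B FOF; case: FOF => FF Fo Ff.
have k0 : (0 < k)%N.
  rewrite lt0n; apply/eqP => k0; apply: (filter_not_empty F).
  by apply: filterS Fk => -[[i s]|q]; rewrite k0.
exists k; first by rewrite k0.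
apply/seteqP; split=> [W|W [B rB BW]]; last first.
  by apply: filterS BW _; apply: filterI => //; exact: Fhull.
move=> /(open_filter_ex _ _ Fo)[U FU [oU UW]].
(* Otherwise the leaves whose ancestor of level [k.-1] is outside [U] form a set [B] in the root's
   ultrafilter, and [U], [hull B] and [below k] meet inside [below k.-1], against the minimality of
   [k]. *)
have rtop : iter (m.+1 - k.-1) ext (level k.-1 U) [::].
  apply: contrapT => nU.
  have rU : iter (m.+1 - k.-1) ext (~` level k.-1 U) [::] by rewrite iter_extC.
  pose B := iter k.-1 behead @^-1` (~` level k.-1 U).
  have /Fhull FB : lim m.+1 [::] B.
    rewrite /lim /= -iterS -(@subnK k.-1 m.+1) ?iterD ?iter_ext_behead //.
    exact: leq_trans (leq_pred k) km.
  have /kmin : `[< F (below k.-1) >].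
    apply/asboolP; apply: filterS (filterI FU (filterI FB Fk)).
    move=> [[i s]|q] [Ux [//= Bx ik]].
    rewrite ltn_neqAle -ltnS prednK // ik andbT; apply/eqP => ik1.
    move: Bx; rewrite ik1 /lim /= iter_ext_behead; apply.
    by rewrite /level /= -ik1 -inl_node.
  by rewrite leqNgt prednK // leqnn.
(* Openness of [U] passes this on from level [k.-1] to all lower levels. *)
have rlow j : (j < k)%N -> lim m.+1 [::] (iter j behead @^-1` level j U).
  move=> jk; rewrite /lim /= -iterS -(@subnK j m.+1); last first.
    exact: leq_trans (ltnW jk) km.
  rewrite iterD iter_ext_behead.
  have jk1 : (j <= k.-1)%N by rewrite -ltnS prednK.
  have -> : (m.+1 - j = (m.+1 - k.-1) + (k.-1 - j))%N.
    by rewrite addnBA // subnK // (leq_trans (leq_pred k)).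
  rewrite iterD; apply: iter_extS rtop.
  rewrite -{1}(subnKC jk1); apply: open_level => //.
  by rewrite subnKC // -ltnS prednK.
(* The leaves whose ancestors of level less than [k] all lie in [U]; a node of such a level in
   [hull B] is an ancestor of one of them. *)
pose B := [set s | forall j, (j < k)%N -> level j U (iter j behead s)].
exists B; last first.
  move=> [[i s]|q] [//= Bs ik]; apply: UW; rewrite inl_node.
  suff : level i U s by [].
  rewrite -(iter_ext_behead i (level i U)).
  by apply: iter_extS Bs => t; apply.
rewrite /B; elim: k {Fk kmin km k0 rtop B} rlow => [|k IH] rlow.
  by apply: filterS filterT.
have rk := rlow k (ltnSn k).
have rIH := IH (fun j jk => rlow j (ltnW jk)).
apply: filterS (filterI rk rIH) => s [sk sIH] j.
by rewrite ltnS leq_eqVlt => /predU1P[->|]; [exact: sk|exact: sIH].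
Qed.

End Tree.

Theorem theorem4p8 (n : nat) (n_gt0 : (0 < n)%N) :
  exists X : topologicalType,
    [/\ hausdorff_space X, infinite_set [set: X], scattered_space X
      & is_chain_of_size (OF X) n].
Proof.
case: n n_gt0 => // m _; have [p pU pfree] := free_ultrafilter_nat.
exists (local_filters_space (@nbase p pU m) (@nbase_filter p pU m)); split.
- exact: hausdorff_space_pt.
- exact: infinite_pt.
- exact: scattered_pt.
split=> [F G|].
  move=> /(OF_chain_filter m)[k _ ->] /(OF_chain_filter m)[l _ ->].
  by case/orP: (leq_total k l) => kl; [right|left]; exact: chain_filterS.
(* The shift to [k.+1] leaves out [chain_filter 0], which is improper. *)
have -> : OF _ = (fun k => @chain_filter p pU m k.+1) @` `I_m.+1.
  apply/seteqP; split=> [F /(OF_chain_filter m)[[//|k] km ->]|_ [k _ <-]].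
    by exists k.
  exact: chain_filter_OF.
apply: inj_card_eq => k l; rewrite !inE /=.
wlog kl : k l / (k < l)%N.
  move=> H km lm kl; case: (ltngtP k l) => // [|/H] lt; first exact: H.
  by rewrite lt.
move=> km lm klE.
have : chain_filter m k.+1 (below m k.+1) by exists setT => //; exact: filterT.
rewrite klE => /(chain_filter_below m l.+1 k.+1 (leq_trans kl lm)).
by rewrite ltnS leqNgt kl.
Qed.
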